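(* (1) The variety of Nelson residuated lattices is term equivalent to the subvariety of integral Nelson-type algebras (those satisfying $x\le e$). (2) The variety of Nelson paraconsistent residuated lattices is term equivalent to the subvariety of odd Nelson-type algebras (those satisfying $\sim e=e$).
   Context: A commutative residuated lattice is an algebra $(A,\wedge,\vee,\cdot,\to,e)$ such that $(A,\wedge,\vee)$ is a lattice, $(A,\cdot,e)$ is a commutative monoid, and $xy\le z$ iff $y\le x\to z$. It is integral if $x\le e$ for all $x$, distributive if its lattice reduct is distributive. A commutative involutive residuated lattice is a commutative residuated lattice with a unary operation $\sim$ satisfying $\sim\sim x=x$ and $x\to\sim y=y\to\sim x$. A bounded residuated lattice is one with an additional constant $\bot$ for its least element. A Nelson residuated lattice is a bounded integral commutative residuated lattice $(A,\vee,\wedge,\cdot,\to,\bot,e)$ which, with $\neg x:=x\to\bot$, satisfies $\neg\neg x=x$ and $(x^2\to y)\wedge((\neg y)^2\to\neg x)=x\to y$. A Nelson paraconsistent residuated lattice (NPc-lattice) is a distributive commutative residuated lattice $(A,\vee,\wedge,\cdot,\to,e)$ which, with $\sim x:=x\to e$, satisfies $\sim\sim x=x$; $(xy)\wedge e=(x\wedge e)(y\wedge e)$; $(x\wedge e)^2=x\wedge e$; and $((x\wedge e)\to y)\wedge((\sim y\wedge e)\to\sim x)=x\to y$. A Nelson-type algebra is a commutative, distributive, involutive residuated lattice $(A,\vee,\wedge,\cdot,\to,\sim,e)$ satisfying $xy=(x\wedge e)^2y\vee x(y\wedge e)^2$ and $(xy\wedge e)^2=(x\wedge e)^2(y\wedge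 e)^2$. Term equivalence of two varieties has its standard meaning: the basic operations of each are interpreted by terms of the other so that every algebra of one variety becomes an algebra of the other on the same universe, and the two translations are mutually inverse. *)

(* Defs.v *)
From mathcomp Require Import all_boot.

Set Implicit Arguments.
Unset Strict Implicit.
Unset Printing Implicit Defensive.

Record signature := Signature {
  symbol : Type;
  arity : symbol -> nat }.

Record algebra (S : signature) := Algebra {
  carrier :> Type;
  op : forall f : symbol S, (arity f).-tuple carrier -> carrier }.

Inductive term (S : signature) (X : Type) : Type :=
| Var of X
| App (f : symbol S) of ('I_(arity f) -> term S X).

Fixpoint eval (S : signature) (A : algebra S) (X : Type) (v : X -> A)
    (t : term S X) : A :=
  match t with
  | Var x => v x
  | App f ts => op [tuple eval v (ts i) | i < arity f]
  end.

Definition translation (S T : signature) : Type :=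
  forall f : symbol S, term T 'I_(arity f).

Definition translate (S T : signature) (tau : translation S T)
    (B : algebra T) : algebra S :=
  @Algebra S B (fun f xs => eval (tnth xs) (tau f)).

Definition alg_class (S : signature) : Type := algebra S -> Prop.

(** Both composite translations keep the carrier definitionally, so that
    "mutually inverse" is equality of the basic operations. *)
Definition term_equivalent (S T : signature)
    (K : alg_class S) (L : alg_class T) : Prop :=
  exists (sigma : translation T S) (tau : translation S T),
    [/\ forall A : algebra S, K A -> L (translate sigma A),
        forall B : algebra T, L B -> K (translate tau B),
        forall A : algebra S, K A -> forall (f : symbol S) (xs : (arity f).-tuple A),
          @op S (translate tau (translate sigma A)) f xs = @op S A f xs
      & forall B : algebra T, L B -> forall (g : symbol T) (xs : (arity g).-tuple B),
          @op T (translate sigma (translate tau B)) g xs = @op T B g xs].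

Inductive crl_symbol := Join | Meet | Mul | Imp | Unit.

Definition crl_arity (f : crl_symbol) : nat := if f is Unit then 0 else 2.

Definition crl_sig : signature := Signature crl_arity.

(** [extend_sig S n] adds to [S] one n-ary symbol, namely [None]. *)
Definition extend_sig (S : signature) (n : nat) : signature :=
  @Signature (option (symbol S)) (fun f => if f is Some g then arity g else n).

Definition reduct (S : signature) (n : nat) (A : algebra (extend_sig S n)) :
    algebra S :=
  @Algebra S A (fun f xs => @op (extend_sig S n) A (Some f) xs).

Declare Scope crl_scope.
Delimit Scope crl_scope with crl.

Definition join (A : algebra crl_sig) (x y : A) : A := @op crl_sig A Join [tuple x; y].
Definition meet (A : algebra crl_sig) (x y : A) : A := @op crl_sig A Meet [tuple x; y].
Definition mul (A : algebra crl_sig) (x y : A) : A := @op crl_sig A Mul [tuple x; y].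
Definition imp (A : algebra crl_sig) (x y : A) : A := @op crl_sig A Imp [tuple x; y].
Definition unit_of (A : algebra crl_sig) : A := @op crl_sig A Unit [tuple].
Definition crl_le (A : algebra crl_sig) (x y : A) : Prop := meet x y = x.
Definition sq (A : algebra crl_sig) (x : A) : A := mul x x.

Notation "x ⊗ y" := (mul x y) (at level 40, left associativity) : crl_scope.
Notation "x ⊓ y" := (meet x y) (at level 48, left associativity) : crl_scope.
Notation "x ⊔ y" := (join x y) (at level 50, left associativity) : crl_scope.
Notation "x ⇒ y" := (imp x y) (at level 55, right associativity) : crl_scope.
Notation "x ⊑ y" := (crl_le x y) (at level 70, no associativity) : crl_scope.
Local Open Scope crl_scope.

Definition is_lattice (A : algebra crl_sig) : Prop :=
  [/\ associative (@meet A), commutative (@meet A),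
      associative (@join A), commutative (@join A)
    & (forall x y : A, x ⊓ (x ⊔ y) = x) /\ (forall x y : A, x ⊔ (x ⊓ y) = x)].

Definition is_comm_monoid (A : algebra crl_sig) : Prop :=
  [/\ associative (@mul A), commutative (@mul A) & left_id (unit_of A) (@mul A)].

Definition is_crl (A : algebra crl_sig) : Prop :=
  [/\ is_lattice A, is_comm_monoid A
    & forall x y z : A, x ⊗ y ⊑ z <-> y ⊑ (x ⇒ z)].

Definition is_integral (A : algebra crl_sig) : Prop :=
  forall x : A, x ⊑ unit_of A.

Definition is_distributive (A : algebra crl_sig) : Prop :=
  right_distributive (@meet A) (@join A).

Definition nrl_sig : signature := extend_sig crl_sig 0.

Definition bot (A : algebra nrl_sig) : reduct A := @op nrl_sig A None [tuple].

Definition is_bounded_crl (A : algebra nrl_sig) : Prop :=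
  is_crl (reduct A) /\ (forall x : reduct A, bot A ⊑ x).

Definition neg (A : algebra nrl_sig) (x : reduct A) : reduct A := x ⇒ bot A.

Definition nelson_rl : alg_class nrl_sig := fun A =>
  [/\ is_bounded_crl A, is_integral (reduct A),
      (forall x : reduct A, neg (neg x) = x)
    & forall x y : reduct A,
        (sq x ⇒ y) ⊓ (sq (neg y) ⇒ neg x) = (x ⇒ y)].

Definition npc_sig : signature := crl_sig.

Definition npc_inv (A : algebra npc_sig) (x : A) : A := x ⇒ unit_of A.

Definition npc_lattice : alg_class npc_sig := fun A =>
  let e := unit_of A in
  [/\ is_crl A /\ is_distributive A,
      (forall x : A, npc_inv (npc_inv x) = x),
      (forall x y : A, (x ⊗ y) ⊓ e = (x ⊓ e) ⊗ (y ⊓ e)),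
      (forall x : A, sq (x ⊓ e) = x ⊓ e)
    & forall x y : A,
        ((x ⊓ e) ⇒ y) ⊓ ((npc_inv y ⊓ e) ⇒ npc_inv x) = (x ⇒ y)].

Definition icrl_sig : signature := extend_sig crl_sig 1.

Definition inv (A : algebra icrl_sig) (x : reduct A) : reduct A :=
  @op icrl_sig A None [tuple x].

Definition is_involutive_crl (A : algebra icrl_sig) : Prop :=
  [/\ is_crl (reduct A),
      (forall x : reduct A, inv (inv x) = x)
    & forall x y : reduct A, (x ⇒ inv y) = (y ⇒ inv x)].

Definition nelson_type : alg_class icrl_sig := fun A =>
  let e := unit_of (reduct A) in
  [/\ is_involutive_crl A, is_distributive (reduct A),
      (forall x y : reduct A,
        x ⊗ y = (sq (x ⊓ e) ⊗ y) ⊔ (x ⊗ sq (y ⊓ e)))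
    & forall x y : reduct A,
        sq ((x ⊗ y) ⊓ e) = sq (x ⊓ e) ⊗ sq (y ⊓ e)].

Definition integral_nelson_type : alg_class icrl_sig := fun A =>
  nelson_type A /\ is_integral (reduct A).

Definition odd_nelson_type : alg_class icrl_sig := fun A =>
  nelson_type A /\ inv (unit_of (reduct A)) = unit_of (reduct A).

(* Main.v *)
(** Put [n x := x ⇒ d], where [d] is [⊥], [e] or [∼e]. If [n] is involutive then
    [x ⇒ n y = n (x ⊗ y)] and [n] is a dual lattice automorphism, so an identity
    [(g x ⇒ y) ⊓ (g (n y) ⇒ n x) = (x ⇒ y)] is the [n]-image of
    [x ⊗ y = (g x ⊗ y) ⊔ (x ⊗ g y)]. With [g x = x²], [x ⊓ e] and [(x ⊓ e)²] this
    matches the Nelson axioms with the first Nelson-type axiom. The identity also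
    says that [x ⊑ y] iff [g x ⊑ y] and [g (n y) ⊑ n x]; this criterion yields
    distributivity of Nelson residuated lattices (where [x² = x⁴]) and idempotence
    of negative elements of odd Nelson-type algebras. *)
From mathcomp Require Import all_boot.
From Stdlib Require Import FunctionalExtensionality Setoid.
Require Import Defs.

Set Implicit Arguments.
Unset Strict Implicit.
Unset Printing Implicit Defensive.

Local Open Scope crl_scope.

(** * Commutative residuated lattices *)

Section ResiduatedLattice.

Variable A : algebra crl_sig.
Hypothesis crlA : is_crl A.

Local Notation e := (unit_of A).
Implicit Types x y z t : A.

Lemma meetA : associative (@meet A). Proof. by case: crlA => [[]]. Qed.
Lemma meetC : commutative (@meet A). Proof. by case: crlA => [[]]. Qed.
Lemma joinA : associative (@join A). Proof. by case: crlA => [[]]. Qed.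
Lemma joinC : commutative (@join A). Proof. by case: crlA => [[]]. Qed.
Lemma joinKI x y : x ⊓ (x ⊔ y) = x. Proof. by case: crlA => [[_ _ _ _ []]]. Qed.
Lemma meetKU x y : x ⊔ (x ⊓ y) = x. Proof. by case: crlA => [[_ _ _ _ []]]. Qed.
Lemma mulA : associative (@mul A). Proof. by case: crlA => [_ []]. Qed.
Lemma mulC : commutative (@mul A). Proof. by case: crlA => [_ []]. Qed.
Lemma mul1 : left_id e (@mul A). Proof. by case: crlA => [_ []]. Qed.
Lemma mulr1 : right_id e (@mul A). Proof. by move=> x; rewrite mulC mul1. Qed.
Lemma residuation x y z : x ⊗ y ⊑ z <-> y ⊑ (x ⇒ z). Proof. by case: crlA. Qed.

Lemma mulACA x y z t : (x ⊗ y) ⊗ (z ⊗ t) = (x ⊗ z) ⊗ (y ⊗ t).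
Proof. by rewrite -!mulA; congr (_ ⊗ _); rewrite !mulA (mulC y). Qed.

Lemma crl_le_refl x : x ⊑ x.
Proof. by have := joinKI x (x ⊓ x); rewrite meetKU. Qed.

Lemma crl_le_trans y x z : x ⊑ y -> y ⊑ z -> x ⊑ z.
Proof. by rewrite /crl_le => xy yz; rewrite -xy -meetA yz. Qed.

Lemma crl_le_anti x y : x ⊑ y -> y ⊑ x -> x = y.
Proof. by rewrite /crl_le => xy <-; rewrite meetC. Qed.

Lemma crl_le_joinE x y : x ⊑ y <-> x ⊔ y = y.
Proof.
rewrite /crl_le; split=> [<-|<-]; last by rewrite joinKI.
by rewrite joinC meetC meetKU.
Qed.

Lemma meet_lel x y : x ⊓ y ⊑ x.
Proof. by rewrite /crl_le meetC meetA crl_le_refl. Qed.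

Lemma meet_ler x y : x ⊓ y ⊑ y.
Proof. by rewrite meetC; apply: meet_lel. Qed.

Lemma le_meet z x y : z ⊑ x -> z ⊑ y -> z ⊑ x ⊓ y.
Proof. by rewrite /crl_le meetA => -> ->. Qed.

Lemma join_gel x y : x ⊑ x ⊔ y.
Proof. exact: joinKI. Qed.

Lemma join_ger x y : y ⊑ x ⊔ y.
Proof. by rewrite joinC; apply: joinKI. Qed.

Lemma join_le x y z : x ⊑ z -> y ⊑ z -> x ⊔ y ⊑ z.
Proof. by move=> /crl_le_joinE xz /crl_le_joinE yz; apply/crl_le_joinE; rewrite -joinA yz. Qed.

Lemma join_le2 x y z t : x ⊑ z -> y ⊑ t -> x ⊔ y ⊑ z ⊔ t.
Proof.
move=> xz yt; apply: join_le; first exact: crl_le_trans xz (join_gel _ _).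
exact: crl_le_trans yt (join_ger _ _).
Qed.

Lemma crl_le_eq x y : (forall z, z ⊑ x <-> z ⊑ y) -> x = y.
Proof. by move=> xy; apply: crl_le_anti; apply/xy; apply: crl_le_refl. Qed.

Lemma le_mul2l x y z : y ⊑ z -> x ⊗ y ⊑ x ⊗ z.
Proof.
move=> yz; apply/residuation; apply: (crl_le_trans yz).
by apply/residuation; apply: crl_le_refl.
Qed.

Lemma le_mul x y z t : x ⊑ z -> y ⊑ t -> x ⊗ y ⊑ z ⊗ t.
Proof.
move=> xz yt; apply: (crl_le_trans (le_mul2l x yt)).
by rewrite !(mulC _ t); apply: le_mul2l.
Qed.

Lemma le_sq x y : x ⊑ y -> sq x ⊑ sq y.
Proof. by move=> xy; apply: le_mul. Qed.

Lemma mul_joinr x y z : x ⊗ (y ⊔ z) = (x ⊗ y) ⊔ (x ⊗ z).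
Proof.
apply: crl_le_anti.
  by apply/residuation; apply: join_le; apply/residuation; [apply: join_gel | apply: join_ger].
by apply: join_le; apply: le_mul2l; [apply: join_gel | apply: join_ger].
Qed.

Lemma mul_joinl x y z : (x ⊔ y) ⊗ z = (x ⊗ z) ⊔ (y ⊗ z).
Proof. by rewrite mulC mul_joinr !(mulC z). Qed.

Lemma mul_le_l x y : y ⊑ e -> x ⊗ y ⊑ x.
Proof. by move=> /(le_mul2l x); rewrite mulr1. Qed.

Lemma mul_le_r x y : x ⊑ e -> x ⊗ y ⊑ y.
Proof. by rewrite mulC; apply: mul_le_l. Qed.

Lemma sq_le x : x ⊑ e -> sq x ⊑ x.
Proof. exact: mul_le_l. Qed.

Lemma mul_le_meet x y : x ⊑ e -> y ⊑ e -> x ⊗ y ⊑ x ⊓ y.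
Proof. by move=> xe ye; apply: le_meet; [apply: mul_le_l | apply: mul_le_r]. Qed.

Lemma le_impE x y : x ⊑ y <-> e ⊑ (x ⇒ y).
Proof. by rewrite -residuation mulr1. Qed.

Lemma imp1 x : (e ⇒ x) = x.
Proof. by apply: crl_le_eq => z; rewrite -residuation mul1. Qed.

Lemma impA x y z : ((x ⊗ y) ⇒ z) = (x ⇒ y ⇒ z).
Proof. by apply: crl_le_eq => t; rewrite -!residuation mulA (mulC y). Qed.

Lemma impCA x y z : (x ⇒ y ⇒ z) = (y ⇒ x ⇒ z).
Proof. by rewrite -!impA mulC. Qed.

Lemma join_imp x y z : ((x ⊔ y) ⇒ z) = (x ⇒ z) ⊓ (y ⇒ z).
Proof.
apply: crl_le_eq => t; rewrite -residuation mul_joinl; split.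
  move=> h; apply: le_meet; apply/residuation; apply: crl_le_trans h;
    [exact: join_gel | exact: join_ger].
by move=> h; apply: join_le; apply/residuation; apply: (crl_le_trans h);
  [apply: meet_lel | apply: meet_ler].
Qed.

(** * Duality given by an involutive residual [x ⇒ d] *)

Section Dualizing.

Variable d : A.
Hypothesis dneg : forall x, ((x ⇒ d) ⇒ d) = x.

Local Notation n x := (x ⇒ d).

Lemma imp_dual x y : (x ⇒ y) = n (x ⊗ n y).
Proof. by rewrite impA dneg. Qed.

Lemma meet_dual x y : n (x ⊓ y) = n x ⊔ n y.
Proof. by rewrite -[RHS]dneg join_imp !dneg. Qed.

(** Residuals turn joins into meets, so the left side of the first identity is [n] of a join of
    products with [n y]. Since [n] is a bijection, [n y] can be exchanged for an arbitrary [y]. *)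
Lemma nelson_identityE (g : A -> A) :
  (forall x y, (g x ⇒ y) ⊓ (g (n y) ⇒ n x) = (x ⇒ y)) <->
  (forall x y, x ⊗ y = (g x ⊗ y) ⊔ (x ⊗ g y)).
Proof.
have dualE x y : (g x ⇒ y) ⊓ (g (n y) ⇒ n x) = n ((g x ⊗ n y) ⊔ (x ⊗ g (n y))).
  by rewrite join_imp -imp_dual impA impCA.
split=> h x y; last by rewrite dualE -h -imp_dual.
by have := h x (n y); rewrite dualE !dneg -impA => /(congr1 (fun z => n z)); rewrite !dneg.
Qed.

Lemma nelson_le (g : A -> A) :
  (forall x y, x ⊗ y = (g x ⊗ y) ⊔ (x ⊗ g y)) ->
  forall x y, g x ⊑ y -> g (n y) ⊑ n x -> x ⊑ y.
Proof.
by move=> /nelson_identityE h x y /le_impE gx /le_impE gy; apply/le_impE; rewrite -h; apply: le_meet.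
Qed.

End Dualizing.

(** The reverse inequality holds in every lattice. *)
Lemma distributive_sub :
  (forall x y z, x ⊓ (y ⊔ z) ⊑ (x ⊓ y) ⊔ (x ⊓ z)) -> is_distributive A.
Proof.
move=> h x y z; apply: crl_le_anti; first exact: h.
apply: join_le; apply: le_meet; try exact: meet_lel.
  exact: crl_le_trans (meet_ler _ _) (join_gel _ _).
exact: crl_le_trans (meet_ler _ _) (join_ger _ _).
Qed.

(** * Distributivity in the integral case *)

Section IntegralNelson.

Hypothesis intA : is_integral A.
Hypothesis mulE : forall x y, x ⊗ y = (sq x ⊗ y) ⊔ (x ⊗ sq y).

(** Taking [y = x] in [mulE] bounds the square by the cube; integrality gives the converse, so all
    powers from the second on coincide. *)
Lemma nelson_sq_idem x : sq (sq x) = sq x.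
Proof.
have cube : x ⊗ sq x = sq x.
  apply: crl_le_anti; first exact: mul_le_r (intA _).
  by rewrite {1}/sq mulE (mulC (sq x)); apply: join_le; apply: crl_le_refl.
by rewrite /sq -mulA -/(sq x) cube cube.
Qed.

(** Only the cross term [x ⊗ y] needs an argument: [mulE] splits it into two products, each with a
    square as a factor and hence below that square. *)
Lemma sq_join_le x y : sq (x ⊔ y) ⊑ sq x ⊔ sq y.
Proof.
have xy : x ⊗ y ⊑ sq x ⊔ sq y.
  by rewrite mulE; apply: join_le2; [apply: mul_le_l | apply: mul_le_r].
rewrite {1}/sq mul_joinr !mul_joinl (mulC y x).
by do 2?[apply: join_le] => //; [apply: join_gel | apply: join_ger].
Qed.

Lemma integral_nelson_distributive d :
  (forall x, ((x ⇒ d) ⇒ d) = x) -> is_distributive A.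
Proof.
move=> dneg; apply: distributive_sub => x y z.
apply: (nelson_le dneg mulE).
  (* Passing to the fourth power leaves two squared factors, one bounded by [sq x] and the other by
     [sq y ⊔ sq z]. Their product distributes over the join, which is not yet known for the meet. *)
  rewrite -nelson_sq_idem /sq -/(sq _).
  apply: (@crl_le_trans (sq x ⊗ (sq y ⊔ sq z))).
    apply: le_mul; first exact: le_sq (meet_lel _ _).
    exact: crl_le_trans (le_sq (meet_ler _ _)) (sq_join_le _ _).
  rewrite mul_joinr; apply: join_le2;
    by apply: crl_le_trans (le_mul (sq_le (intA _)) (sq_le (intA _))) (mul_le_meet _ _).
(* By De Morgan the second condition is the dual distributive law with its left side squared:
   [sq ((p ⊔ q) ⊓ (p ⊔ r)) ⊑ p ⊔ (q ⊓ r)]. *)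
rewrite join_imp !(meet_dual dneg) join_imp.
move: (x ⇒ d) (y ⇒ d) (z ⇒ d) => p q r.
rewrite -nelson_sq_idem /sq -/(sq _).
apply: (@crl_le_trans ((sq p ⊔ sq q) ⊗ (sq p ⊔ sq r))).
  by apply: le_mul; apply: crl_le_trans (sq_join_le _ _); apply: le_sq;
    [apply: meet_lel | apply: meet_ler].
(* This covers every term of the expanded product except [sq q ⊗ sq r], which lies below [q ⊓ r]. *)
have sqp t : sq p ⊗ t ⊑ p ⊔ (q ⊓ r).
  apply: crl_le_trans (join_gel _ _); apply: crl_le_trans (sq_le (intA _)).
  exact: mul_le_l.
rewrite mul_joinl !mul_joinr (mulC (sq q) (sq p)).
do 2?[apply: join_le] => //.
apply: crl_le_trans (join_ger _ _).
exact: crl_le_trans (le_mul (sq_le (intA _)) (sq_le (intA _))) (mul_le_meet _ _).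
Qed.

End IntegralNelson.

(** For [x ⊑ e], the criterion [nelson_le] is applied to [x ⊑ sq x] with [g] sending [x] to
    [sq (x ⊓ e)]. The first condition is reflexivity; the second asks that [x] times the square of a
    negative element be below [e]. *)
Lemma odd_nelson_neg_idem :
  (forall x, ((x ⇒ e) ⇒ e) = x) ->
  (forall x y, x ⊗ y = (sq (x ⊓ e) ⊗ y) ⊔ (x ⊗ sq (y ⊓ e))) ->
  forall x, sq (x ⊓ e) = x ⊓ e.
Proof.
move=> dneg mulE x; have xe := meet_ler x e; move: (x ⊓ e) xe => {}x xe.
apply: crl_le_anti; first exact: sq_le.
apply: (nelson_le dneg mulE); first by rewrite xe; apply: crl_le_refl.
have ye := meet_ler (sq x ⇒ e) e; move: (_ ⊓ e) ye => y ye.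
apply: (iffLR (residuation _ _ _)); apply: crl_le_trans (mul_le_r _ xe) _.
exact: crl_le_trans (sq_le ye) ye.
Qed.

End ResiduatedLattice.

Section Involution.

Variable B : algebra icrl_sig.
Hypothesis invB : is_involutive_crl B.

Let crlB : is_crl (reduct B). Proof. by case: invB. Qed.

(** Contraposition exchanges [x] and [e], and [e ⇒ ∼x] is [∼x]. Thus [∼e] can serve as the dualizing
    element [d]. *)
Lemma inv_imp (x : reduct B) : (x ⇒ inv (unit_of (reduct B))) = inv x.
Proof. by case: invB => _ _ ->; rewrite imp1. Qed.

Lemma inv_dneg (x : reduct B) :
  ((x ⇒ inv (unit_of (reduct B))) ⇒ inv (unit_of (reduct B))) = x.
Proof. by rewrite !inv_imp; case: invB. Qed.

(** By contraposition, [∼e ⊑ x] amounts to [∼x ⊑ e]. This makes [∼e] the interpretation of [⊥]. *)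
Lemma integral_inv_unit_le :
  is_integral (reduct B) -> forall x : reduct B, inv (unit_of (reduct B)) ⊑ x.
Proof.
move=> intB x; apply: (iffRL (le_impE crlB _ _)); case: invB => _ invK impC.
by rewrite -(invK x) impC; apply: (iffLR (le_impE crlB _ _)); rewrite invK; apply: intB.
Qed.

End Involution.

(** * Translations *)

Lemma inv_tnth (B : algebra icrl_sig) (xs : 1.-tuple B) :
  @inv B (tnth xs ord0) = @op icrl_sig B None xs.
Proof.
by apply: (congr1 (@op icrl_sig B None)); apply: eq_from_tnth => i; rewrite !ord1.
Qed.

(** Explicit form of a translated algebra: the operations of its [reduct] compute to those of [A],
    so laws of [A] carry over without evaluating terms. *)
Definition expand (S : signature) (n : nat) (A : algebra S)
    (o : n.-tuple A -> A) : algebra (extend_sig S n) :=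
  @Algebra (extend_sig S n) A (fun f =>
    match f return (@arity (extend_sig S n) f).-tuple A -> A with
    | Some g => @op S A g
    | None => o
    end).

(** Allows a translated algebra to be rewritten as its explicit form, although evaluated terms match
    it only up to propositional equality of tuples. *)
Lemma eq_algebra (S : signature) (A : algebra S)
    (o : forall f : symbol S, (arity f).-tuple A -> A) :
  (forall f xs, @op S A f xs = o f xs) -> A = Algebra o.
Proof.
case: A o => T o o' oo'; congr Algebra; apply: functional_extensionality_dep => f.
exact: functional_extensionality_dep.
Qed.

Lemma eval_basic (S : signature) (A : algebra S) (f : symbol S) (xs : (arity f).-tuple A) :
  eval (tnth xs) (App (f := f) (@Var S _)) = op xs.
Proof. by congr op; apply: eq_from_tnth => i; rewrite tnth_mktuple. Qed.

Lemma mktuple1 (T : Type) (F : 'I_1 -> T) : [tuple F i | i < 1] = [tuple F ord0].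
Proof. by apply: eq_from_tnth => i; rewrite tnth_mktuple !ord1. Qed.

Lemma mktuple2 (T : Type) (F : 'I_2 -> T) : [tuple F i | i < 2] = [tuple F ord0; F ord_max].
Proof.
apply: eq_from_tnth => i; rewrite tnth_mktuple.
by case: i => [[|[|//]] lti]; congr F; apply: val_inj.
Qed.

Definition nrl_of_icrl : translation nrl_sig icrl_sig := fun f =>
  match f with
  | Some g => @App icrl_sig _ (Some g) (@Var icrl_sig _)
  | None => @App icrl_sig _ None (fun _ => @App icrl_sig _ (Some Unit) (@Var icrl_sig _))
  end.

Definition icrl_of_nrl : translation icrl_sig nrl_sig := fun f =>
  match f with
  | Some g => @App nrl_sig _ (Some g) (@Var nrl_sig _)
  | None => @App nrl_sig _ (Some Imp) (fun i : 'I_2 =>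
      if i == ord0 then @Var nrl_sig 'I_1 ord0
      else @App nrl_sig _ None (fun _ => @Var nrl_sig 'I_1 ord0))
  end.

Definition crl_of_icrl : translation crl_sig icrl_sig := fun f =>
  @App icrl_sig _ (Some f) (@Var icrl_sig _).

Definition icrl_of_crl : translation icrl_sig crl_sig := fun f =>
  match f with
  | Some g => @App crl_sig _ g (@Var crl_sig _)
  | None => @App crl_sig _ Imp (fun i : 'I_2 =>
      if i == ord0 then @Var crl_sig 'I_1 ord0
      else @App crl_sig _ Unit (fun _ => @Var crl_sig 'I_1 ord0))
  end.

Lemma op_nrl_of_icrl (B : algebra icrl_sig) (f : symbol nrl_sig) (xs : (arity f).-tuple B) :
  @op nrl_sig (translate nrl_of_icrl B) f xs =
  @op nrl_sig (@expand crl_sig 0 (reduct B) (fun _ => inv (unit_of (reduct B)))) f xs.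
Proof.
case: f xs => [g|] xs; first exact: (@eval_basic icrl_sig B (Some g)).
rewrite /= mktuple1; apply: (congr1 (@inv B)).
(* The two argument tuples have length zero, so they agree vacuously. *)
by rewrite /unit_of /=; congr op; apply: eq_from_tnth => -[].
Qed.

Lemma op_icrl_of_nrl (A : algebra nrl_sig) (f : symbol icrl_sig) (xs : (arity f).-tuple A) :
  @op icrl_sig (translate icrl_of_nrl A) f xs =
  @op icrl_sig (@expand crl_sig 1 (reduct A) (fun ys => @neg A (tnth ys ord0))) f xs.
Proof.
case: f xs => [g|] xs; first exact: (@eval_basic nrl_sig A (Some g)).
rewrite /= mktuple2; apply: (congr1 (@imp (reduct A) (tnth xs ord0))).
by rewrite /bot /=; congr op; apply: eq_from_tnth => -[].
Qed.

Lemma op_icrl_of_crl (A : algebra crl_sig) (f : symbol icrl_sig) (xs : (arity f).-tuple A) :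
  @op icrl_sig (translate icrl_of_crl A) f xs =
  @op icrl_sig (@expand crl_sig 1 A (fun ys => npc_inv (tnth ys ord0))) f xs.
Proof.
case: f xs => [g|] xs; first exact: (@eval_basic crl_sig A g).
rewrite /= mktuple2; apply: (congr1 (@imp A (tnth xs ord0))).
by rewrite /unit_of /=; congr op; apply: eq_from_tnth => -[].
Qed.

Lemma op_crl_of_icrl (B : algebra icrl_sig) (f : crl_symbol) (xs : (crl_arity f).-tuple B) :
  @op crl_sig (translate crl_of_icrl B) f xs = @op crl_sig (reduct B) f xs.
Proof. exact: (@eval_basic icrl_sig B (Some f)). Qed.

(** * Translated algebras satisfy the target axioms *)

Lemma nelson_rl_integral_nelson_type (A : algebra nrl_sig) :
  nelson_rl A -> integral_nelson_type (translate icrl_of_nrl A).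
Proof.
case=> -[crlA _] intA dneg nelsonA; rewrite (@eq_algebra _ (translate icrl_of_nrl A) _ (@op_icrl_of_nrl A)).
have /(nelson_identityE crlA dneg) mulE := nelsonA.
have distrA := integral_nelson_distributive crlA intA mulE dneg.
(* Integrality means [x ⊓ e = x], so [mulE] already is the product law and the square law only
   rearranges factors. *)
have mulE' (x y : reduct A) :
    x ⊗ y = (sq (x ⊓ unit_of _) ⊗ y) ⊔ (x ⊗ sq (y ⊓ unit_of _)).
  by rewrite {1}mulE (intA x) (intA y).
have sq_mul (x y : reduct A) :
    sq ((x ⊗ y) ⊓ unit_of _) = sq (x ⊓ unit_of _) ⊗ sq (y ⊓ unit_of _).
  by rewrite (intA x) (intA y) (intA (x ⊗ y)); apply: (mulACA crlA).
split; last exact: intA.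
split.
- by split=> //= x y; apply: (impCA crlA).
- exact: distrA.
- exact: mulE'.
- exact: sq_mul.
Qed.

Lemma integral_nelson_type_nelson_rl (B : algebra icrl_sig) :
  integral_nelson_type B -> nelson_rl (translate nrl_of_icrl B).
Proof.
case=> -[invB _ mulE _] intB; rewrite (@eq_algebra _ (translate nrl_of_icrl B) _ (@op_nrl_of_icrl B)).
have crlB : is_crl (reduct B) by case: invB.
split=> [||x|].
- by split; [exact: crlB | exact: (integral_inv_unit_le invB intB)].
- exact: intB.
- exact: (inv_dneg invB x).
- apply/(nelson_identityE crlB (inv_dneg invB)) => x y.
  by rewrite {1}mulE (intB x) (intB y).
Qed.

Lemma npc_lattice_odd_nelson_type (A : algebra crl_sig) :
  npc_lattice A -> odd_nelson_type (translate icrl_of_crl A).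
Proof.
case=> -[crlA distrA] dneg mul_meet idem nelsonA; rewrite (@eq_algebra _ (translate icrl_of_crl A) _ (@op_icrl_of_crl A)).
have /(nelson_identityE crlA dneg) mulE := nelsonA.
split; last exact: (imp1 crlA).
split=> [||x y|x y].
- by split=> //= x y; apply: (impCA crlA).
- exact: distrA.
(* Idempotence of negative elements identifies [x ⊓ e] with its square, the form required of a
   Nelson-type algebra. *)
- by apply: etrans (mulE x y) _; rewrite -{1}(idem x) -{1}(idem y).
- by apply: etrans (idem _) _; rewrite mul_meet -{1}(idem x) -{1}(idem y).
Qed.

Lemma odd_nelson_type_npc_lattice (B : algebra icrl_sig) :
  odd_nelson_type B -> npc_lattice (translate crl_of_icrl B).
Proof.
case=> -[invB distrB mulE sq_mul] odd; rewrite (@eq_algebra _ (translate crl_of_icrl B) _ (@op_crl_of_icrl B)).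
have crlB : is_crl (reduct B) by case: invB.
(* Oddness moves the dualizing element from [∼e] to [e]. *)
have dneg := inv_dneg invB; rewrite odd in dneg.
have idem := odd_nelson_neg_idem crlB dneg mulE.
split=> // [x y|]; first by rewrite -idem sq_mul !idem.
apply/(nelson_identityE crlB dneg (fun x => x ⊓ unit_of (reduct B))) => x y.
by rewrite {1}mulE !idem.
Qed.

Theorem lemma31 :
  term_equivalent nelson_rl integral_nelson_type /\
  term_equivalent npc_lattice odd_nelson_type.
Proof.
split.
  exists icrl_of_nrl, nrl_of_icrl; split.
  - exact: nelson_rl_integral_nelson_type.
  - exact: integral_nelson_type_nelson_rl.
  - move=> A [[crlA _] _ _ _] f xs; rewrite op_nrl_of_icrl.
    case: f xs => [g|] xs; first exact: (@op_icrl_of_nrl A (Some g) xs).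
    (* The constant returns as [∼e], read as [e ⇒ ⊥], which is [⊥]. *)
    apply: etrans (@op_icrl_of_nrl A None _) _; rewrite (tuple0 xs).
    apply: etrans (imp1 crlA (bot A)).
    exact: (congr1 (@neg A) (@op_icrl_of_nrl A (Some Unit) _)).
  - move=> B [[invB _ _ _] _] f xs; rewrite op_icrl_of_nrl.
    case: f xs => [g|] xs; first exact: (@op_nrl_of_icrl B (Some g) xs).
    (* The involution returns as [x ⇒ ∼e]. *)
    apply: etrans (@op_nrl_of_icrl B (Some Imp) _) _.
    rewrite /bot op_nrl_of_icrl; apply: etrans (inv_imp invB _) _.
    exact: inv_tnth.
exists icrl_of_crl, crl_of_icrl; split.
- exact: npc_lattice_odd_nelson_type.
- exact: odd_nelson_type_npc_lattice.
- move=> A _ f xs; rewrite op_crl_of_icrl; exact: (@op_icrl_of_crl A (Some f) xs).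
- move=> B [[invB _ _ _] odd] f xs; rewrite op_icrl_of_crl.
  case: f xs => [g|] xs; first exact: (@op_crl_of_icrl B g xs).
  apply: etrans (@op_crl_of_icrl B Imp _) _.
  (* Here the involution returns as [x ⇒ e]; oddness writes this as [x ⇒ ∼e], so that [inv_imp]
     applies. *)
  rewrite /unit_of op_crl_of_icrl -/(unit_of (reduct B)) -odd.
  by apply: etrans (inv_imp invB _) _; apply: inv_tnth.
Qed.
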